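(* Let $(\Delta,\mathcal D,\mathbb P)$ be a probability space, $\mathcal X\subseteq\mathbb R^d$, $f:\mathcal X\to\mathbb R$, $g:\mathcal X\to\mathbb R^q$, $b:\Delta\to\mathbb R^q$, let $\beta\in(0,1)$, and let $\delta_1,\dots,\delta_N$ be independent draws from $(\Delta,\mathcal D,\mathbb P)$. Consider the non-convex additively-uncertain scenario problem $$\min_{x\in\mathcal X} f(x)\quad\text{s.t. } g(x)\le b(\delta_i),\ i=1,\dots,N. \qquad (\mathrm{SP})$$ For each $\ell=1,\dots,q$ let $$i_\ell=\arg\min_{i=1,\dots,N} b_\ell(\delta_i)$$ (a unique index being selected via a tie-break rule, e.g. the smallest index, if the minimum is attained more than once), let $\mathcal I_N=\{i_1,\dots,i_q\}$, and let $\varsigma_N$ be the number of elements of the set $\mathcal I_N$, i.e. the number of distinct $i_\ell$'s. Then, for any $\mathbb P$, the risk of the possibly sub-optimal (feasible) solution $\hat x_N^\star$ of (SP) satisfies $$\mathbb P^N\{V(\hat x_N^\star)\le\epsilon_{N,\beta}(\varsigma_N)\}\ge 1-\beta.$$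
   Context: Vector inequalities are componentwise; $b_\ell$ is the $\ell$-th component of $b$, and $N,q\ge1$. No convexity of $\mathcal X$, $f$ or $g$ is assumed. Standing assumption: (SP) is feasible with probability one, for every $N$. A ''possibly sub-optimal solution'' $\hat x_N^\star$ of (SP) is a point of $\mathcal X$, depending on the data-set $(\delta_1,\dots,\delta_N)$, that satisfies all constraints of (SP), not necessarily a minimizer. The risk of $x\in\mathcal X$ is $V(x)=\mathbb P\{\delta\in\Delta:\ g(x)\not\le b(\delta)\}$. $\mathbb P^N$ is the product probability on $(\Delta^N,\mathcal D^{\otimes N})$, the law of $(\delta_1,\dots,\delta_N)$. As is implicit in writing these probabilities, the sets involved are assumed measurable. The function $\epsilon_{N,\beta}:\{0,1,\dots,N\}\to[0,1]$ is defined by $\epsilon_{N,\beta}(N)=1$ and, for $k=0,1,\dots,N-1$, $\epsilon_{N,\beta}(k)=1-t(k)$, where $t(k)$ is the unique solution in $[0,1]$ of $$\frac{\beta}{N}\sum_{m=k}^{N-1}\binom{m}{k}t^{m-k}-\binom{N}{k}t^{N-k}=0.$$ *)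

(* Defs.v *)
From HB Require Import structures.
From mathcomp Require Import all_boot all_order all_algebra all_fingroup.
From mathcomp Require Import all_classical all_reals all_analysis.

Set Implicit Arguments.
Unset Strict Implicit.
Unset Printing Implicit Defensive.

Import Order.TTheory GRing.Theory Num.Theory.
Import numFieldNormedType.Exports.

Local Open Scope classical_set_scope.
Local Open Scope ring_scope.

Section iid.
Context d (T : measurableType d) (R : realType).

Definition cons_pair n (x : T * n.-tuple T) : n.+1.-tuple T :=
  [tuple of x.1 :: x.2].

Lemma measurable_cons_pair n : measurable_fun setT (@cons_pair n).
Proof. exact: measurable_cons measurable_fst measurable_snd. Qed.

HB.instance Definition _ n :=
  isMeasurableFun.Build _ _ _ _ (@cons_pair n) (@measurable_cons_pair n).

(* The n-fold product of P on [n.-tuple T] with the product sigma-algebra: the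
   point mass at the empty tuple, then the image of P \x P^n under
   (x, w) |-> x :: w. It is characterized by [iid_prob_box]. *)
Fixpoint iid_prob (P : probability T R) n : probability (n.-tuple T) R :=
  match n with
  | 0 => \d_([tuple])
  | n'.+1 => distribution (P \x iid_prob P n')%E (@cons_pair n')
  end.

Lemma measurable_box n (A : 'I_n -> set T) : (forall i, measurable (A i)) ->
  measurable [set w : n.-tuple T | forall i, A i (tnth w i)].
Proof.
move=> mA; rewrite (_ : [set w | _] =
    \big[setI/setT]_(i < n) ((@tnth n T ^~ i) @^-1` A i)).
  apply: bigsetI_measurable => i _; rewrite -[X in measurable X]setTI.
  exact: measurable_tnth.
by apply/seteqP; split => w; rewrite -bigcap_seq /= => h i;
  [move=> _; exact: h | apply: h; exact: mem_index_enum].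
Qed.

Lemma iid_prob_box (P : probability T R) n (A : 'I_n -> set T) :
  (forall i, measurable (A i)) ->
  iid_prob P n [set w | forall i, A i (tnth w i)] = (\prod_(i < n) P (A i))%E.
Proof.
elim: n A => [|n IH] A mA.
  rewrite big_ord0 /= diracE mem_set//=; by case.
rewrite big_ord_recl -IH//= /distribution /pushforward.
have mB : measurable [set w : n.-tuple T | forall i, A (lift ord0 i) (tnth w i)].
  by apply: (@measurable_box n (fun i => A (lift ord0 i))).
transitivity ((P \x iid_prob P n)%E (A ord0 `*`
    [set w : n.-tuple T | forall i, A (lift ord0 i) (tnth w i)])); last first.
  by rewrite product_measure1E.
congr (_ _); apply/seteqP; split => -[x w] /=.
  move=> h; split => [|i]; first exact: (h ord0).
  by have := h (lift ord0 i); rewrite /cons_pair tnthS.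
move=> [h0 h] i; have [j ->|->//] := unliftP ord0 i.
by rewrite /cons_pair tnthS; exact: h.
Qed.

End iid.

Section epsilon.
Context (R : realType).

Definition eps_root (N : nat) (beta : R) (k : nat) (t : R) : Prop :=
  beta / N%:R * (\sum_(k <= m < N) 'C(m, k)%:R * t ^+ (m - k))
    - 'C(N, k)%:R * t ^+ (N - k) = 0.

(* [get] picks an element of the set; by [eps_root_exists_unique] there is
   exactly one when 0 < beta < 1 and k < N. Only k <= N is meaningful. *)
Definition eps (N : nat) (beta : R) (k : nat) : R :=
  if (k < N)%N then 1 - get [set t : R | 0 <= t <= 1 /\ eps_root N beta k t]
  else 1.

Lemma sum_bin_col k N : (\sum_(k <= m < N) 'C(m, k) = 'C(N, k.+1))%N.
Proof.
elim: N => [|N IH]; first by rewrite big_geq.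
have [kN|Nk] := leqP k N; first by rewrite big_nat_recr//= IH binS addnC.
by rewrite big_geq// bin_small.
Qed.

Lemma eps_root_exists_unique (N : nat) (beta : R) (k : nat) :
  0 < beta < 1 -> (k < N)%N ->
  exists! t, 0 <= t <= 1 /\ eps_root N beta k t.
Proof.
move=> /andP[b0 b1] kN; have N0 : 0 < N%:R :> R by rewrite ltr0n (leq_ltn_trans _ kN).
pose p : {poly R} := (beta / N%:R) *: (\sum_(k <= m < N) 'C(m, k)%:R *: 'X^(m - k))
    - 'C(N, k)%:R *: 'X^(N - k).
have pE t : p.[t] = beta / N%:R * (\sum_(k <= m < N) 'C(m, k)%:R * t ^+ (m - k))
    - 'C(N, k)%:R * t ^+ (N - k).
  rewrite /p !hornerE horner_sum; congr (_ * _ - _).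
  by apply: eq_bigr => m _; rewrite !hornerE.
have p0 : 0 < p.[0].
  rewrite pE big_ltn// subnn binn expr0 mulr1 big_nat_cond big1 => [|m].
    by rewrite addr0 mulr1 expr0n subn_eq0 leqNgt kN mulr0 subr0 divr_gt0.
  by rewrite andbT => /andP[km _]; rewrite expr0n subn_eq0 leqNgt km mulr0.
have p1 : p.[1] <= 0.
  rewrite pE expr1n mulr1; under eq_bigr do rewrite expr1n mulr1.
  rewrite -natr_sum sum_bin_col subr_le0 mulrAC ler_pdivrMr//.
  rewrite -natrM (@le_trans _ _ 'C(N, k.+1)%:R)//.
    by rewrite ler_piMl// ?ler0n// ltW.
  rewrite ler_nat (@leq_trans (k.+1 * 'C(N, k.+1)))//; first exact: leq_pmull.
  by rewrite mul_bin_left mulnC leq_mul2l leq_subr orbT.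
have [t t01 /eqP tr] : exists2 t, 0 <= t <= 1 & root (- p) t.
  have := @poly_ivt R (- p) 0 1 ler01; rewrite !hornerN oppr_le0 oppr_ge0.
  move=> /(_ _)[|t]; first by rewrite (ltW p0) p1.
  by move=> ?; exists t.
have rE u : eps_root N beta k u <-> p.[u] = 0 by rewrite pE.
exists t; split.
  by split => //; apply/rE; move/eqP: tr; rewrite hornerN oppr_eq0 => /eqP.
have lt_ne u v : 0 <= u -> p.[u] = 0 -> p.[v] = 0 -> u < v -> False.
  move=> u0 pu pv uv.
  have {}u0 : 0 < u.
    by rewrite lt_neqAle u0 andbT; apply/negP => /eqP u00; rewrite -u00 in pu; rewrite pu ltxx in p0.
  have v0 : 0 < v by exact: lt_trans uv.
  move: pu pv; rewrite !pE => /eqP; rewrite subr_eq0 => /eqP pu /eqP.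
  rewrite subr_eq0 => /eqP pv.
  have : beta / N%:R * (\sum_(k <= m < N) 'C(m, k)%:R * u ^+ (m - k)) * v ^+ (N - k)
       = beta / N%:R * (\sum_(k <= m < N) 'C(m, k)%:R * v ^+ (m - k)) * u ^+ (N - k).
    by rewrite pu pv mulrAC.
  apply/eqP; rewrite gt_eqF// -!(mulrA (beta / _)) ltr_pM2l ?divr_gt0// !mulr_suml.
  apply: ltr_sum_nat => // m /andP[km mN].
  rewrite -!mulrA ltr_pM2l ?ltr0n ?bin_gt0//.
  have -> : (N - k = (m - k) + (N - m))%N by rewrite addnBAC// subnKC// ltnW.
  rewrite !exprD [ltLHS]mulrCA ltr_pM2l ?exprn_gt0// ltr_pM2l ?exprn_gt0//.
  by rewrite ltrXn2r ?subn_eq0 -?ltnNge// ltW.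
move=> u [/andP[u0 u1] /rE pu]; have {}tr : p.[t] = 0.
  by move/eqP: tr; rewrite hornerN oppr_eq0 => /eqP.
case/andP: t01 => t0 _; have [tu|ut|//] := ltgtP t u.
  by case: (lt_ne _ _ t0 tr pu tu).
by case: (lt_ne _ _ u0 pu tr ut).
Qed.

End epsilon.

Section scenario.
Context d (T : measurableType d) (R : realType) (n q N : nat).

Definition vle (u v : 'rV[R]_q) : Prop := forall l, u ord0 l <= v ord0 l.

Definition feasible (X : set 'rV[R]_n) (g : 'rV[R]_n -> 'rV[R]_q)
    (b : T -> 'rV[R]_q) (w : N.-tuple T) : set 'rV[R]_n :=
  [set x | X x /\ forall i, vle (g x) (b (tnth w i))].

Definition risk (P : probability T R) (g : 'rV[R]_n -> 'rV[R]_q)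
    (b : T -> 'rV[R]_q) (x : 'rV[R]_n) : \bar R :=
  P [set delta | ~ vle (g x) (b delta)].

(* Among the indices attaining the minimum, the one of least rank [s i] is
   selected, via the lexicographic order; [s = 1] selects the smallest index.
   The minimizer being unique, [i0] only witnesses that 'I_N is inhabited. *)
Definition argmin_idx (i0 : 'I_N) (s : 'S_N) (y : 'I_N -> R) : 'I_N :=
  [arg min_(i < i0) ((y i, s i) : R *l 'I_N)]%O.

Lemma argmin_idxP (i0 : 'I_N) (s : 'S_N) (y : 'I_N -> R) j :
  let i := argmin_idx i0 s y in
  y i <= y j /\ (y i = y j -> (s i <= s j)%N).
Proof.
rewrite /argmin_idx.
case: (@Order.TotalTheory.arg_minP _ _ _ i0 xpredT
  (fun i => ((y i, s i) : R *l 'I_N))) => // i _ /(_ j isT).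
rewrite Order.ProdLexiOrder.leEprodlexi /= => /andP[le_ij /implyP h].
by split => // e; apply: h; rewrite e.
Qed.

Definition argmin_set (i0 : 'I_N) (s : 'I_q -> 'S_N) (b : T -> 'rV[R]_q)
    (w : N.-tuple T) : {set 'I_N} :=
  [set argmin_idx i0 (s l) (fun i => b (tnth w i) ord0 l) | l : 'I_q]%SET.

End scenario.

(* Main.v *)
Require Import Defs.
From HB Require Import structures.
From mathcomp Require Import all_boot all_order all_algebra all_fingroup.
From mathcomp Require Import all_classical all_reals all_analysis.
From mathcomp Require Import measurable_realfun zify ring lra.
Set Implicit Arguments.
Unset Strict Implicit.
Unset Printing Implicit Defensive.
Import Order.TTheory GRing.Theory Num.Theory.
Import numFieldNormedType.Exports.
Local Open Scope classical_set_scope.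
Local Open Scope ring_scope.

(** For scenario sets [K \subset M], let [A K M] be the event that [K] is the set
of indices selected when only the scenarios in [M] are present. Given the
scenarios in [K], each further scenario [i] independently leaves the selection
unchanged with some probability [u_i], which depends on [i] through the tie-break
rule; hence [P (A K M)] is the integral of [1_(A K K) * \prod_(i in M :\: K) u_i].
If [K] is selected from all [N] scenarios and the risk exceeds [eps N beta #|K|],
then every [u_i] is below the root [t = 1 - eps N beta #|K|], so the product of
all [u_i] is at most [t ^+ #|L|] times the product over the complement of [L].
Averaging over [L] with weights [1 / (N * 'C(N, #|L|))] and using the equation
that defines [t], the probability of this bad event is at most
[beta * \sum_(L | L != set0) P (A K (~: L)) / (N * 'C(N, #|L|))]. For fixed [L]
the events [A K (~: L)] are disjoint in [K], and the weights add up to 1, so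
summing over [K] gives [beta]. *)

Lemma measurable_set_bool disp (T : measurableType disp) (C : T -> bool) :
  measurable_fun setT C -> measurable [set w | C w].
Proof. by move=> mC; rewrite -[X in measurable X]setTI; exact: mC. Qed.

(** * Resampling one coordinate of an i.i.d. tuple *)

Section Resampling.
Context disp (T : measurableType disp) (R : realType) (P : probability T R).

Definition upd n (w : n.-tuple T) (i : 'I_n) (x : T) : n.-tuple T :=
  [tuple if j == i then x else tnth w j | j < n].

Lemma tnth_upd n (w : n.-tuple T) i x j :
  tnth (upd w i x) j = if j == i then x else tnth w j.
Proof. by rewrite tnth_mktuple. Qed.

Lemma upd_cons0 n (x y : T) (w : n.-tuple T) :
  upd (cons_pair (x, w)) ord0 y = cons_pair (y, w).
Proof.
apply: eq_from_tnth => j; rewrite tnth_upd.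
by have [k ->|->] := unliftP ord0 j; rewrite ?eqxx//= !tnthS.
Qed.

Lemma upd_consS n (x y : T) (w : n.-tuple T) (i : 'I_n) :
  upd (cons_pair (x, w)) (lift ord0 i) y = cons_pair (x, upd w i y).
Proof.
apply: eq_from_tnth => j; rewrite tnth_upd.
have [k ->|->] := unliftP ord0 j; last by [].
by rewrite !tnthS tnth_upd (inj_eq lift_inj).
Qed.

Lemma measurable_upd n (i : 'I_n) :
  measurable_fun setT (fun z : n.-tuple T * T => upd z.1 i z.2).
Proof.
apply/measurable_fun_tnthP => j /=.
rewrite (_ : _ \o _ = fun z : n.-tuple T * T =>
  if j == i then z.2 else tnth z.1 j); last first.
  by apply/funext => z /=; rewrite tnth_upd.
case: (j == i); first exact: measurable_snd.
apply: (@measurableT_comp _ _ _ _ _ _ (fun w : n.-tuple T => tnth w j)) => //.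
exact: measurable_tnth.
Qed.

Lemma measurable_updr n (w : n.-tuple T) (i : 'I_n) :
  measurable_fun setT (upd w i).
Proof. exact: (measurableT_comp (measurable_upd i) (pair1_measurable w)). Qed.

Lemma integral_iid_probS n (h : n.+1.-tuple T -> \bar R) :
  measurable_fun setT h -> (forall w, (0 <= h w)%E) ->
  (\int[iid_prob P n.+1]_w h w =
   \int[P]_x \int[iid_prob P n]_w h (cons_pair (x, w)))%E.
Proof.
move=> mh h0 /=; rewrite ge0_integral_distribution//.
rewrite fubini_tonelli1//.
  by apply: measurableT_comp => //; exact: measurable_cons_pair.
by move=> z; exact: h0.
Qed.

(** By induction on [n]. A coordinate of the tail is handled by the induction hypothesis under the
    outer integral; for the head, the resampled integrand no longer depends on it, and Tonelli
    restores the order of integration. *)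
Lemma integral_iid_prob_resample n (i : 'I_n) (h : n.-tuple T -> \bar R) :
  measurable_fun setT h -> (forall w, (0 <= h w)%E) ->
  (\int[iid_prob P n]_w h w =
   \int[iid_prob P n]_w \int[P]_x h (upd w i x))%E.
Proof.
have mint m (k : 'I_m) (g : m.-tuple T -> \bar R) :
    measurable_fun setT g -> (forall w, (0 <= g w)%E) ->
    measurable_fun setT (fun w => \int[P]_x g (upd w k x))%E.
  move=> mg g0; apply: (measurable_fun_fubini_tonelli_F (m2 := P)
    (fun z : m.-tuple T * T => g (upd z.1 k z.2))) => //.
  by apply: measurableT_comp => //; exact: measurable_upd.
elim: n i h => [[]//|n IH] i h mh h0.
have mhc : measurable_fun setT (fun z : T * n.-tuple T => h (cons_pair z)).
  by apply: measurableT_comp => //; exact: measurable_cons_pair.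
rewrite (integral_iid_probS mh h0) [RHS](integral_iid_probS (mint _ i h mh h0)); last first.
  by move=> w; exact: integral_ge0.
have [j ->|->] := unliftP ord0 i.
  apply: eq_integral => x _.
  rewrite (IH j _ (measurableT_comp mhc (pair1_measurable x)) (fun=> h0 _)).
  by apply: eq_integral => w _; apply: eq_integral => y _; rewrite upd_consS.
under [RHS]eq_integral do under eq_integral do under eq_integral do
  rewrite upd_cons0.
rewrite [RHS]integral_cst//= probability_setT mule1.
by rewrite (fubini_tonelli (fun z : T * n.-tuple T => h (cons_pair z))).
Qed.

(** Conditional probability of [C] given all coordinates but [i]. With [C := dominated K i] it is
    the [u_i] of the overview. *)
Definition resample_prob n (i : 'I_n) (C : n.-tuple T -> bool) (w : n.-tuple T) : R :=
  fine (P [set x | C (upd w i x)]).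

Lemma measurable_resample n (i : 'I_n) (C : n.-tuple T -> bool) w :
  measurable_fun setT C -> measurable [set x | C (upd w i x)].
Proof.
move=> mC; apply: (measurable_set_bool (C := fun x => C (upd w i x))).
exact: (measurableT_comp mC (measurable_updr w i)).
Qed.

Lemma resample_prob_ge0 n (i : 'I_n) C w : 0 <= resample_prob i C w.
Proof. exact: fine_ge0. Qed.

Lemma measurable_resample_prob n (i : 'I_n) (C : n.-tuple T -> bool) :
  measurable_fun setT C -> measurable_fun setT (resample_prob i C).
Proof.
move=> mC; apply: measurableT_comp => //=.
have mA : measurable [set z : n.-tuple T * T | C (upd z.1 i z.2)].
  have mf : measurable_fun setT (fun z : n.-tuple T * T => C (upd z.1 i z.2)).
    by apply: measurableT_comp => //; exact: measurable_upd.
  exact: measurable_set_bool.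
have := measurable_fun_xsection P mA.
by congr measurable_fun; apply/funext => w /=; congr (P _);
  apply/seteqP; split => x; rewrite /xsection/= inE.
Qed.

Lemma measurable_natr_bool d0 (U : measurableType d0) (C : U -> bool) :
  measurable_fun setT C -> measurable_fun setT (fun w => (C w)%:R : R).
Proof.
move=> mC; rewrite (_ : (fun w => _) = fun w => if C w then 1 else 0 : R).
  by apply: measurable_fun_ifT => //.
by apply/funext => w; case: (C w).
Qed.

Lemma integral_natr_bool d0 (U : measurableType d0) (mu : probability U R)
    (C : U -> bool) : measurable_fun setT C ->
  (\int[mu]_w ((C w)%:R : R)%:E = mu [set w | C w])%E.
Proof.
move=> mC.
have mA : measurable [set w | C w].
  exact: measurable_set_bool.
transitivity (\int[mu]_w ((\1_[set w | C w] w : R)%:E))%E.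
  by apply: eq_integral => w _; rewrite indicE mem_setE.
by rewrite integral_indic// setIT.
Qed.

(** Resampling coordinate [i] leaves [phi] fixed, so only the indicator of [C] is averaged. *)
Lemma integral_mul_resample n (i : 'I_n) (phi : n.-tuple T -> R)
    (C : n.-tuple T -> bool) :
  measurable_fun setT phi -> (forall w, 0 <= phi w) -> measurable_fun setT C ->
  (forall w x, phi (upd w i x) = phi w) ->
  (\int[iid_prob P n]_w (phi w * (C w)%:R)%:E =
   \int[iid_prob P n]_w (phi w * resample_prob i C w)%:E)%E.
Proof.
move=> mphi phi0 mC inv; rewrite (integral_iid_prob_resample i)//; last first.
- by move=> w; rewrite lee_fin mulr_ge0.
- apply/measurable_EFinP; apply: measurable_funM => //.
  exact: measurable_natr_bool.
apply: eq_integral => w _.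
under eq_integral do rewrite inv EFinM.
have mCw : measurable_fun setT (fun x => C (upd w i x)).
  exact: (measurableT_comp mC (measurable_updr w i)).
rewrite ge0_integralZl//.
- by rewrite integral_natr_bool// EFinM fineK ?fin_num_measure//; exact: measurable_resample.
- by apply/measurable_EFinP; exact: measurable_natr_bool.
- by rewrite lee_fin; exact: phi0.
Qed.

Lemma upd_upd n (w : n.-tuple T) i x y : upd (upd w i x) i y = upd w i y.
Proof. by apply: eq_from_tnth => j; rewrite !tnth_upd; case: (j == i). Qed.

Lemma upd_updC n (w : n.-tuple T) i j x y : i != j ->
  upd (upd w i x) j y = upd (upd w j y) i x.
Proof.
move=> ij; apply: eq_from_tnth => k; rewrite !tnth_upd.
by have [->|//] := eqVneq k j; rewrite eq_sym (negbTE ij).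
Qed.

(** Conditional independence: each [C j] ignores the coordinates of [r] other than its own. In the
    induction on [r], the head indicator joins [phi] while the tail is averaged, and is itself
    averaged last. *)
Lemma integral_prod_resample n (r : seq 'I_n) (phi : n.-tuple T -> R)
    (C : 'I_n -> n.-tuple T -> bool) :
  uniq r ->
  measurable_fun setT phi -> (forall w, 0 <= phi w) ->
  (forall i, measurable_fun setT (C i)) ->
  (forall i w x, i \in r -> phi (upd w i x) = phi w) ->
  (forall i j w x, i \in r -> j != i -> C j (upd w i x) = C j w) ->
  (\int[iid_prob P n]_w (phi w * \prod_(i <- r) (C i w)%:R)%:E =
   \int[iid_prob P n]_w (phi w * \prod_(i <- r) resample_prob i (C i) w)%:E)%E.
Proof.
move=> + + + mC; elim: r phi => [|i r IH] phi ur mphi phi0 inv invC.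
  by apply: eq_integral => w _; rewrite !big_nil.
move: ur => /= /andP[ir ur].
under eq_integral do rewrite big_cons mulrA.
rewrite IH//; last first.
- move=> j k w x jr; apply: invC; by rewrite inE jr orbT.
- move=> j w x jr; rewrite inv ?inE ?jr ?orbT// invC ?inE ?jr ?orbT//.
  by apply: contraNneq ir => ->.
- by move=> w; rewrite mulr_ge0.
- by apply: measurable_funM => //; exact: measurable_natr_bool.
under eq_integral do rewrite mulrAC.
rewrite (integral_mul_resample (i := i))//.
- by apply: eq_integral => w _; rewrite big_cons mulrA mulrAC.
- apply: measurable_funM => //; apply: measurable_prod => j _.
  exact: measurable_resample_prob.
- by move=> w; rewrite mulr_ge0// prodr_ge0// => j _; exact: resample_prob_ge0.
(* The averages already taken do not depend on coordinate [i]: updates at distinct coordinates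
   commute, and [C j] ignores [i]. *)
- move=> w x; rewrite inv ?inE ?eqxx//; congr (_ * _).
  apply: eq_big_seq => j jr; rewrite /resample_prob; congr (fine (P _)).
  have ji : j != i by apply: contraNneq ir => <-.
  apply/funext => y /=; rewrite upd_updC 1?eq_sym//.
  by rewrite invC ?inE ?eqxx.
Qed.

End Resampling.

(** * Binomial identities and the equation defining [t] *)

Section Weights.
Local Open Scope nat_scope.

(** Both sides count the choices of disjoint subsets of sizes [j] and [k] among [N] elements. *)
Lemma mul_bin_exchange N j k : j + k <= N ->
  'C(N, j) * 'C(N - j, k) = 'C(N, k) * 'C(N - k, j).
Proof.
move=> jkN; have jN : j <= N := leq_trans (leq_addr k j) jkN.
have kN : k <= N := leq_trans (leq_addl j k) jkN.
apply/eqP; rewrite -(eqn_pmul2r (fact_gt0 (N - j - k))).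
rewrite -(eqn_pmul2r (fact_gt0 k)) -(eqn_pmul2r (fact_gt0 j)); apply/eqP.
transitivity (N`!).
  rewrite -(bin_fact jN) -(bin_fact (_ : k <= N - j)) ?leq_subRL//; ring.
rewrite -(bin_fact kN) -(bin_fact (_ : j <= N - k)); last first.
  by rewrite leq_subRL// addnC.
by rewrite (subnAC N j k); ring.
Qed.

End Weights.

Section Combinatorics.
Context (R : realType).

Lemma sum_subset_card (I : finType) (D : {set I}) (f : nat -> R) :
  \sum_(L : {set I} | L \subset D) f #|L| =
  \sum_(j < #|D|.+1) 'C(#|D|, j)%:R * f j.
Proof.
rewrite (partition_big (fun L : {set I} => inord #|L| : 'I_#|D|.+1) xpredT)//=.
apply: eq_bigr => j _.
rewrite (eq_bigl (fun L : {set I} => L \in [set A : {set I} | A \subset D & #|A| == j])).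
  rewrite (eq_bigr (fun=> f j)) => [|L]; last by rewrite inE => /andP[_ /eqP ->].
  by rewrite sumr_const cards_draws mulr_natl.
move=> L; rewrite inE; case: (boolP (L \subset D)) => //= LD.
by rewrite -val_eqE/= inordK// ltnS subset_leq_card.
Qed.

(** Each of the [N] positive sizes receives total mass [1/N], shared equally among the subsets of
    that size. *)
Definition weight N (j : nat) : R := (N%:R * 'C(N, j)%:R)^-1.

Lemma weight_ge0 N j : 0 <= weight N j.
Proof. by rewrite invr_ge0 mulr_ge0. Qed.

Lemma sum_weight N : (0 < N)%N ->
  \sum_(L : {set 'I_N} | L != finset.set0) weight N #|L| = 1.
Proof.
move=> N0; have := sum_subset_card [set: 'I_N]%SET (weight N).
rewrite (bigD1 finset.set0) ?finset.sub0set//= cards0 big_ord_recl bin0 mul1r.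
move/addrI; rewrite cardsT card_ord => e.
rewrite (eq_bigl (fun L : {set 'I_N} => (L \subset [set: 'I_N]%SET) && (L != finset.set0))).
  rewrite e; transitivity (\sum_(j < N) (N%:R^-1 : R)).
    apply: eq_bigr => j _; rewrite /weight invfM mulrCA divff ?mulr1//.
    by rewrite pnatr_eq0 -lt0n bin_gt0; exact: ltn_ord j.
  by rewrite sumr_const card_ord -[LHS]mulr_natl divff// pnatr_eq0 -lt0n.
by move=> L; rewrite finset.subsetT.
Qed.

(** This is the equation of [t] divided by its subtracted term: with [m = N - j.+1],
    [mul_bin_exchange] turns ['C(m, k) / 'C(N, k)] into ['C(N - k, j.+1) / 'C(N, j.+1)]. *)
Lemma eps_root_weight N (beta : R) k t : (k < N)%N -> 0 < t ->
  eps_root N beta k t ->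
  beta * (\sum_(j < N - k) 'C(N - k, j.+1)%:R * (weight N j.+1 * t ^- j.+1)) = 1.
Proof.
move=> kN t0 /eqP; rewrite subr_eq0 => /eqP rt.
have B0 : 'C(N, k)%:R != 0 :> R by rewrite pnatr_eq0 -lt0n bin_gt0 ltnW.
have T0 : t ^+ (N - k) != 0 by rewrite expf_neq0// gt_eqF.
have BT0 : 'C(N, k)%:R * t ^+ (N - k) != 0 by rewrite mulf_neq0.
apply: (mulIf BT0); rewrite mul1r -[RHS]rt -[LHS]mulrA -[RHS]mulrA.
congr (beta * _); rewrite mulr_suml mulr_sumr.
(* The index [m] is shifted by [k] and reversed, giving [m = N - j.+1]. *)
rewrite -[in RHS](add0n k) big_addn big_mkord [RHS](reindex_inj rev_ord_inj)/=.
apply: eq_bigr => j _; have jn := ltn_ord j.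
rewrite addnK (_ : (N - k - j.+1 + k = N - j.+1)%N); last by lia.
have C0 : 'C(N, j.+1)%:R != 0 :> R by rewrite pnatr_eq0 -lt0n bin_gt0; lia.
have N0 : N%:R != 0 :> R by rewrite pnatr_eq0; lia.
have tj0 : t ^+ j.+1 != 0 by rewrite expf_neq0// gt_eqF.
have jkN : (j.+1 + k <= N)%N by lia.
have := congr1 (fun x => x%:R : R) (mul_bin_exchange jkN); rewrite !natrM => e.
have -> : t ^+ (N - k) = t ^+ (N - k - j.+1) * t ^+ j.+1.
  by rewrite -exprD; congr (_ ^+ _); lia.
have -> : 'C(N - j.+1, k)%:R = 'C(N, k)%:R * 'C(N - k, j.+1)%:R / 'C(N, j.+1)%:R :> R.
  by rewrite -e mulrAC divff// mul1r.
by rewrite /weight; field; rewrite N0 C0.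
Qed.

(** By [eps_root_weight] with [N - k = #|D|], the numbers [beta * weight * t^-#|L|] sum to 1 over
    the nonempty [L] in [D]. The product is multiplied by this 1, and each [t^-1] absorbs one factor
    [u i <= t] with [i] in [L]. *)
Lemma prod_le_weighted N (beta : R) (D : {set 'I_N}) t (u : 'I_N -> R) :
  0 <= beta -> D != finset.set0 -> 0 < t -> eps_root N beta (N - #|D|) t ->
  (forall i, i \in D -> 0 <= u i <= t) ->
  \prod_(i in D) u i <= beta *
   \sum_(L : {set 'I_N} | (L \subset D) && (L != finset.set0))
     weight N #|L| * \prod_(i in D :\: L) u i.
Proof.
move=> b0 D0 t0 rt ut; set p := \prod_(i in D) u i.
have p0 : 0 <= p by apply: prodr_ge0 => i /ut /andP[].
have DN : (#|D| <= N)%N by rewrite -[N in (_ <= N)%N]card_ord max_card.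
have cD : (0 < #|D|)%N by rewrite card_gt0.
have := eps_root_weight _ t0 rt; rewrite subKn// => /(_ _) e.
have {e} e : beta * \sum_(L : {set 'I_N} | (L \subset D) && (L != finset.set0))
    (weight N #|L| * t ^- #|L|) = 1.
  rewrite -[RHS]e; last by lia.
  congr (_ * _); have := sum_subset_card D (fun j => weight N j * t ^- j).
  rewrite (bigD1 finset.set0) ?finset.sub0set//= cards0 big_ord_recl bin0 mul1r.
  by move/addrI => ->; apply: eq_bigr.
rewrite -[leLHS]mul1r -[X in X * p]e -mulrA ler_wpM2l// mulr_suml ler_sum// => L /andP[LD _].
rewrite -mulrA ler_wpM2l ?weight_ge0//.
rewrite mulrC ler_pdivrMr ?exprn_gt0//.
rewrite /p (big_setID L)/= (finset.setIidPr LD) mulrC ler_wpM2l//.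
  by apply: prodr_ge0 => i; rewrite inE => /andP[_ /ut /andP[]].
rewrite -prodr_const; apply: ler_prod => i iL; exact/ut/(fintype.subsetP LD).
Qed.

Lemma eps_complexity N (beta : R) k : 0 < beta < 1 -> (k < N)%N ->
  eps_root N beta k (1 - eps N beta k).
Proof.
move=> b01 kN; rewrite /eps kN opprB addrCA subrr addr0.
have [t [ht _]] := eps_root_exists_unique b01 kN.
by case: (@getPex _ [set t | 0 <= t <= 1 /\ eps_root N beta k t] (ex_intro _ t ht)).
Qed.

End Combinatorics.

(** * Measurability of finite quantifiers *)

Section MeasurableQuantifiers.
Context disp (T : measurableType disp) (I : finType).

Lemma measurable_forall (F : I -> T -> bool) :
  (forall i, measurable_fun setT (F i)) ->
  measurable_fun setT (fun w => [forall i, F i w]).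
Proof.
move=> mF; rewrite (_ : (fun w => _) = fun w => all (F^~ w) (enum I)).
  by elim: (enum I) => //= i r IH; exact: measurable_and.
apply/funext => w; apply/forallP/allP => [h i _|h i]; first exact: h.
by apply: h; rewrite mem_enum.
Qed.

Lemma measurable_exists (F : I -> T -> bool) :
  (forall i, measurable_fun setT (F i)) ->
  measurable_fun setT (fun w => [exists i, F i w]).
Proof.
move=> mF; rewrite (_ : (fun w => _) = fun w => ~~ [forall i, ~~ F i w]).
  by apply: measurable_neg; apply: measurable_forall => i; exact: measurable_neg.
by apply/funext => w; rewrite negb_forall; apply: eq_existsb => i; rewrite negbK.
Qed.

Lemma measurable_forall_in (A : {set I}) (F : I -> T -> bool) :
  (forall i, measurable_fun setT (F i)) ->
  measurable_fun setT (fun w => [forall i in A, F i w]).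
Proof.
by move=> mF; apply: measurable_forall => i; case: (i \in A) => /=;
  [exact: mF|exact: measurable_cst].
Qed.

Lemma measurable_exists_in (A : {set I}) (F : I -> T -> bool) :
  (forall i, measurable_fun setT (F i)) ->
  measurable_fun setT (fun w => [exists i in A, F i w]).
Proof.
by move=> mF; apply: measurable_exists => i; case: (i \in A) => /=;
  [exact: mF|exact: measurable_cst].
Qed.

End MeasurableQuantifiers.

(** * Selected index sets and their probabilities *)

Section Support.
Context disp (Delta : measurableType disp) (R : realType) (q N : nat).
Variables (b : Delta -> 'rV[R]_q) (s : 'I_q -> 'S_N).

(** The pair compared by [argmin_idx]; the rank in second place makes keys of distinct scenarios
    distinct. *)
Definition key (l : 'I_q) (w : N.-tuple Delta) (i : 'I_N) : R *l 'I_N :=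
  (b (tnth w i) ord0 l, s l i).

Lemma key_inj l w : injective (key l w).
Proof. by move=> i j e; apply: (@perm_inj _ (s l)); exact: (congr1 snd e). Qed.

Definition minimal_in (M : {set 'I_N}) l w i : bool :=
  [forall j in M, (key l w i <= key l w j)%O].

(* For [K \subset M], this says that [K] is the set of the indices selected when
   only the scenarios in [M] are present. *)
Definition is_support (K M : {set 'I_N}) w : bool :=
  [forall l, exists i in K, minimal_in M l w i] &&
  [forall i in K, exists l, minimal_in M l w i].

(* Adding scenario [j] to those in [K] leaves the minimum in each component
   attained inside [K]. *)
Definition dominated (K : {set 'I_N}) (j : 'I_N) w : bool :=
  [forall l, exists i in K, (key l w i <= key l w j)%O].

(** By transitivity, an index minimal in [K] stays minimal in [M] once every scenario of [M :\: K]
    lies above some member of [K]. The right side separates an event about [K] alone from events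
    each involving one further scenario. *)
Lemma is_support_dominated (K M : {set 'I_N}) w : K \subset M ->
  is_support K M w = is_support K K w && [forall j in M :\: K, dominated K j w].
Proof.
move=> KM; apply/idP/idP => [/andP[/forallP cov /forall_inP act]|].
  apply/andP; split; first apply/andP; first split.
  - apply/forallP => l; have /exists_inP[i iK /forall_inP mi] := cov l.
    apply/exists_inP; exists i => //; apply/forall_inP => j jK.
    by apply: mi; exact: (fintype.subsetP KM).
  - apply/forall_inP => i /act /existsP[l /forall_inP mi].
    apply/existsP; exists l; apply/forall_inP => j jK.
    by apply: mi; exact: (fintype.subsetP KM).
  - apply/forall_inP => j; rewrite inE => /andP[_ jM]; apply/forallP => l.
    have /exists_inP[i iK /forall_inP mi] := cov l.
    by apply/exists_inP; exists i => //; exact: mi.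
move=> /andP[/andP[/forallP cov /forall_inP act] /forall_inP dom].
have ext l i : i \in K -> minimal_in K l w i -> minimal_in M l w i.
  move=> iK /forall_inP mi; apply/forall_inP => j jM.
  have [/mi//|jK] := boolP (j \in K).
  have /forallP/(_ l)/exists_inP[k kK kj] : dominated K j w.
    by apply: dom; rewrite inE jK.
  exact: le_trans (mi _ kK) kj.
apply/andP; split.
  apply/forallP => l; have /exists_inP[i iK mi] := cov l.
  by apply/exists_inP; exists i => //; exact: ext.
apply/forall_inP => i iK; have /existsP[l mi] := act i iK.
by apply/existsP; exists l; exact: ext.
Qed.

(** Keys are distinct, so each component has a single minimal index in [M], and both sets consist of
    exactly these indices. *)
Lemma is_support_unique (K K' M : {set 'I_N}) w :
  K \subset M -> K' \subset M -> is_support K M w -> is_support K' M w -> K = K'.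
Proof.
move=> KM K'M sK sK'; apply/eqP; rewrite finset.eqEsubset.
have sub (A B : {set 'I_N}) : A \subset M -> B \subset M ->
    is_support A M w -> is_support B M w -> A \subset B.
  move=> AM BM /andP[_ /forall_inP act] /andP[/forallP cov _].
  apply/fintype.subsetP => i iA; have /existsP[l /forall_inP mi] := act i iA.
  have /exists_inP[j jB /forall_inP mj] := cov l.
  suff -> : i = j by [].
  apply: (@key_inj l w); apply/le_anti.
  by rewrite mi ?(fintype.subsetP BM)//= mj// (fintype.subsetP AM).
by apply/andP; split; exact: sub.
Qed.

Lemma is_support_argmin_set i0 w : is_support (argmin_set i0 s b w) [set: 'I_N]%SET w.
Proof.
have min l : minimal_in [set: 'I_N]%SET l w
    (argmin_idx i0 (s l) (fun i => b (tnth w i) ord0 l)).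
  rewrite /argmin_idx; apply/forall_inP => j _.
  by case: Order.TotalTheory.arg_minP => // i _ /(_ j isT).
apply/andP; split.
  apply/forallP => l; apply/exists_inP; eexists; last exact: min.
  exact: imset_f.
by apply/forall_inP => i /imsetP[l _ ->]; apply/existsP; exists l.
Qed.

Hypothesis hb : forall l, measurable_fun setT (fun delta => b delta ord0 l).

Lemma measurable_key_le l i j :
  measurable_fun setT (fun w => (key l w i <= key l w j)%O).
Proof.
have mb k : measurable_fun setT (fun w : N.-tuple Delta => b (tnth w k) ord0 l).
  exact: (measurableT_comp (hb l) (measurable_tnth k)).
under eq_fun do rewrite Order.ProdLexiOrder.leEprodlexi /= implybE.
by apply: measurable_and; [|apply: measurable_or => //; apply: measurable_neg];
  exact: measurable_fun_ler.
Qed.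

Lemma measurable_is_support K M : measurable_fun setT (is_support K M).
Proof.
have mM l i : measurable_fun setT (fun w => minimal_in M l w i).
  by apply: measurable_forall_in => j; exact: measurable_key_le.
apply: measurable_and.
  by apply: measurable_forall => l; apply: measurable_exists_in.
by apply: measurable_forall_in => i; exact: measurable_exists.
Qed.

Lemma measurable_dominated K j : measurable_fun setT (dominated K j).
Proof.
apply: measurable_forall => l; apply: measurable_exists_in => i.
exact: measurable_key_le.
Qed.

Lemma key_upd l w i x j : j != i -> key l (upd w i x) j = key l w j.
Proof. by move=> ji; rewrite /key tnth_upd (negbTE ji). Qed.

Lemma is_support_upd (K : {set 'I_N}) w i x : i \notin K ->
  is_support K K (upd w i x) = is_support K K w.
Proof.
move=> iK; have neq j : j \in K -> j != i by apply: contraTneq => ->.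
have minE l j : j \in K -> minimal_in K l (upd w i x) j = minimal_in K l w j.
  move=> jK; apply: eq_forallb_in => k kK.
  by rewrite !key_upd ?neq.
congr (_ && _).
  by apply: eq_forallb => l; apply: eq_existsb_in => j jK; exact: minE.
by apply: eq_forallb_in => j jK; apply: eq_existsb => l; exact: minE.
Qed.

Lemma dominated_upd (K : {set 'I_N}) w i x j : i \notin K -> j != i ->
  dominated K j (upd w i x) = dominated K j w.
Proof.
move=> iK ji; have neq k : k \in K -> k != i by apply: contraTneq => ->.
apply: eq_forallb => l; apply: eq_existsb_in => k kK.
by rewrite (key_upd l w x ji) key_upd ?neq.
Qed.

Variable P : probability Delta R.

(** After [is_support_dominated], the factors for the scenarios of [M :\: K] are averaged by
    [integral_prod_resample]. [G] is [risky] for the bad event and trivial for the events it is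
    compared with. *)
Lemma iid_prob_is_support (K M : {set 'I_N}) (G : N.-tuple Delta -> bool) :
  K \subset M -> measurable_fun setT G ->
  (forall w i x, i \notin K -> G (upd w i x) = G w) ->
  iid_prob P N [set w | G w && is_support K M w] =
  (\int[iid_prob P N]_w ((G w && is_support K K w)%:R *
     \prod_(i in M :\: K) resample_prob P i (dominated K i) w)%:E)%E.
Proof.
move=> KM mG invG.
have mGK : measurable_fun setT (fun w => G w && is_support K K w).
  by apply: measurable_and => //; exact: measurable_is_support.
rewrite -integral_natr_bool; last first.
  by apply: measurable_and => //; exact: measurable_is_support.
have inMK i : i \in enum (M :\: K) -> i \notin K.
  by rewrite mem_enum inE => /andP[].
transitivity (\int[iid_prob P N]_w ((G w && is_support K K w)%:R *
    \prod_(i <- enum (M :\: K)) (dominated K i w)%:R)%:E)%E.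
  apply: eq_integral => w _; congr (_%:E).
  rewrite (is_support_dominated w KM) andbA -mulnb natrM; congr (_ * _).
  rewrite big_enum/= -natr_prod; congr (_%:R).
  have [/forall_inP dom|/forall_inPn[i iMK ndom]] :=
    boolP [forall i in M :\: K, dominated K i w].
    by rewrite big1// => i /dom ->.
  by rewrite (bigD1 i)//= (negbTE ndom) mul0n.
rewrite integral_prod_resample//.
- by apply: eq_integral => w _; rewrite big_enum.
- exact: enum_uniq.
- exact: measurable_natr_bool.
- by move=> i; exact: measurable_dominated.
- by move=> i w x /inMK iK; rewrite invG// is_support_upd.
- by move=> i j w x /inMK iK ji; rewrite dominated_upd.
Qed.

Lemma sum_iid_prob_is_support_le1 (M : {set 'I_N}) :
  (\sum_(K : {set 'I_N} | K \subset M) iid_prob P N [set w | is_support K M w]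
   <= 1)%E.
Proof.
rewrite (eq_bigr (fun K =>
    \int[iid_prob P N]_w ((is_support K M w)%:R : R)%:E)%E); last first.
  by move=> K _; rewrite integral_natr_bool//; exact: measurable_is_support.
rewrite -[leLHS]big_filter -ge0_integral_sum//; last first.
  by move=> K; apply/measurable_EFinP; apply: measurable_natr_bool; exact: measurable_is_support.
rewrite -[leRHS](@probability_setT _ _ _ (iid_prob P N)) -[leRHS]mul1e.
rewrite -integral_cst//; apply: ge0_le_integral => //.
- by move=> w _; apply: sume_ge0.
- apply: emeasurable_sum => K.
  by apply/measurable_EFinP; apply: measurable_natr_bool; exact: measurable_is_support.
move=> w _; rewrite big_filter sumEFin lee_fin.
have [/existsP[K /andP[KM sK]]|/existsPn none] :=
    boolP [exists K : {set 'I_N}, (K \subset M) && is_support K M w].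
  rewrite (bigD1 K)//= sK big1 ?addr0// => K' /andP[K'M neq].
  case: (boolP (is_support K' M w)) => // sK'.
  by rewrite (is_support_unique KM K'M sK sK') eqxx in neq.
rewrite big1 ?ler01// => K KM; have := none K; rewrite KM /=.
by move=> /negbTE ->.
Qed.

(* By [resample_prob_dominated_le], this contains the outcomes with support [K] at
   which the solution has risk larger than [1 - t]; unlike the risk of the
   solution, it is measurable and depends only on the scenarios in [K]. *)
Definition risky (K : {set 'I_N}) (t : R) (w : N.-tuple Delta) : bool :=
  [forall i in ~: K, resample_prob P i (dominated K i) w < t].

Lemma measurable_risky K t : measurable_fun setT (risky K t).
Proof.
apply: measurable_forall_in => i; apply: measurable_fun_ltr => //.
by apply: measurable_resample_prob; exact: measurable_dominated.
Qed.

(** Among the coordinates outside [K], [dominated K j] depends only on the [j]-th, which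
    [resample_prob] averages out. *)
Lemma risky_upd (K : {set 'I_N}) t w i x : i \notin K ->
  risky K t (upd w i x) = risky K t w.
Proof.
move=> iK; apply: eq_forallb_in => j; rewrite inE => jK.
congr (_ < t); rewrite /resample_prob; congr (fine (P _)).
apply/funext => y /=; have [->|ij] := eqVneq i j; first by rewrite upd_upd.
by rewrite upd_updC// dominated_upd// eq_sym.
Qed.

(** [prod_le_weighted] is applied pointwise under the integral with [D = ~: K]. Each resulting term
    integrates to a probability of selection from [~: L], since [~: L :\: K = ~: K :\: L]. *)
Lemma iid_prob_risky_le (K : {set 'I_N}) (beta t : R) :
  0 <= beta -> K != [set: 'I_N]%SET -> eps_root N beta #|K| t ->
  (iid_prob P N [set w | risky K t w && is_support K [set: 'I_N]%SET w] <=
   \sum_(L : {set 'I_N} | (L \subset ~: K) && (L != finset.set0))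
     (beta * weight R N #|L|)%:E *
     iid_prob P N [set w | is_support K (~: L) w])%E.
Proof.
move=> beta0 KT rt.
have mres i : measurable_fun setT (resample_prob P i (dominated K i)).
  by apply: measurable_resample_prob; exact: measurable_dominated.
have mterm (G : N.-tuple Delta -> bool) (A : {set 'I_N}) :
    measurable_fun setT G -> measurable_fun setT (fun w => (G w)%:R *
      \prod_(i in A) resample_prob P i (dominated K i) w).
  move=> mG; apply: measurable_funM; first exact: measurable_natr_bool.
  under eq_fun do rewrite -big_enum.
  by apply: measurable_prod.
have prod_ge0 (A : {set 'I_N}) w :
    0 <= \prod_(i in A) resample_prob P i (dominated K i) w.
  by apply: prodr_ge0 => i _; exact: resample_prob_ge0.
rewrite iid_prob_is_support ?finset.subsetT//; last 2 first.
- exact: measurable_risky.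
- by move=> w i x iK; exact: risky_upd.
rewrite finset.setTD.
have E (L : {set 'I_N}) : L \subset ~: K ->
    iid_prob P N [set w | is_support K (~: L) w] =
    (\int[iid_prob P N]_w ((is_support K K w)%:R *
     \prod_(i in ~: K :\: L) resample_prob P i (dominated K i) w)%:E)%E.
  move=> LK; have KL : K \subset ~: L by rewrite -finset.setCS finset.setCK.
  have := iid_prob_is_support (G := xpredT) KL; rewrite /= => -> //.
  by apply: eq_integral => w _; congr (_ * _)%:E; apply: eq_bigl => i; rewrite !inE andbC.
under eq_bigr => L /andP[LK _].
  rewrite (E L LK) -ge0_integralZl//; last first.
  - by rewrite lee_fin mulr_ge0 ?weight_ge0.
  - by move=> w _; rewrite lee_fin mulr_ge0.
  - by apply/measurable_EFinP; apply: mterm; exact: measurable_is_support.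
  over.
rewrite -[leRHS]big_filter -ge0_integral_sum//; last 2 first.
- move=> L; apply: emeasurable_funM => //.
  by apply/measurable_EFinP; apply: mterm; exact: measurable_is_support.
- by move=> L w _; rewrite -EFinM lee_fin !mulr_ge0 ?weight_ge0.
apply: ge0_le_integral => //.
- by move=> w _; rewrite lee_fin mulr_ge0.
- apply/measurable_EFinP; apply: mterm; apply: measurable_and; first exact: measurable_risky.
  exact: measurable_is_support.
- apply: emeasurable_sum => L; apply: emeasurable_funM => //.
  by apply/measurable_EFinP; apply: mterm; exact: measurable_is_support.
move=> w _; rewrite big_filter/=; under [leRHS]eq_bigr do rewrite -EFinM.
rewrite sumEFin lee_fin.
have [/andP[/forall_inP rk ->]|_] := boolP (risky K t w && is_support K K w); last first.
  rewrite mul0r sumr_ge0// => L _; by rewrite !mulr_ge0 ?weight_ge0.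
rewrite mul1r; under [leRHS]eq_bigr do rewrite mul1r -mulrA.
rewrite -mulr_sumr; apply: (prod_le_weighted (t := t)) => //.
- by apply: contraNneq KT => KC; rewrite -(finset.setCK K) KC finset.setC0.
(* [t] is positive because [~: K] is nonempty and some [u_i >= 0] lies strictly below [t]. *)
- have [i iK] : exists i, i \in ~: K.
    by apply/set0Pn; apply: contraNneq KT => KC; rewrite -(finset.setCK K) KC finset.setC0.
  exact: le_lt_trans (resample_prob_ge0 _ _ _ _) (rk i iK).
- by rewrite cardsCs finset.setCK card_ord subKn// -[leqRHS]card_ord max_card.
by move=> i iK; rewrite resample_prob_ge0 ltW// rk.
Qed.

Lemma sum_iid_prob_risky_le (beta : R) : (0 < N)%N -> 0 < beta < 1 ->
  (\sum_(K : {set 'I_N} | K != [set: 'I_N]%SET)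
     iid_prob P N [set w | risky K (1 - eps N beta #|K|) w &&
                           is_support K [set: 'I_N]%SET w] <= beta%:E)%E.
Proof.
move=> N0 beta01; have beta0 : 0 <= beta by case/andP: beta01 => /ltW.
apply: (@le_trans _ _ (\sum_(K : {set 'I_N})
    \sum_(L : {set 'I_N} | (L \subset ~: K) && (L != finset.set0))
     (beta * weight R N #|L|)%:E *
     iid_prob P N [set w | is_support K (~: L) w])%E).
  rewrite [leRHS](bigID (fun K => K != [set: 'I_N]%SET))/=.
  rewrite -[leLHS]adde0; apply: leeD; last first.
    apply: sume_ge0 => K _; apply: sume_ge0 => L _.
    by rewrite mule_ge0// lee_fin mulr_ge0 ?weight_ge0.
  apply: lee_sum => K KT; apply: iid_prob_risky_le => //.
  apply: eps_complexity => //.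
  rewrite ltn_neqAle -[X in _ && (_ <= X)%N]card_ord max_card andbT.
  apply: contra KT => /eqP kN; rewrite finset.eqEcard finset.subsetT/=.
  by rewrite cardsT card_ord kN.
rewrite (exchange_big_dep (fun L => L != finset.set0))/=; last first.
  by move=> K L _ /andP[].
apply: (@le_trans _ _ (\sum_(L : {set 'I_N} | L != finset.set0)
    (beta * weight R N #|L|)%:E)%E).
  apply: lee_sum => L L0.
  rewrite -ge0_sume_distrr//.
  rewrite -[leRHS]mule1; apply: lee_wpmul2l.
    by rewrite lee_fin mulr_ge0 ?weight_ge0.
  (* [L \subset ~: K] amounts to [K \subset ~: L], so the inner sum runs over the sets selectable
     from [~: L]. *)
  rewrite (eq_bigl (fun K : {set 'I_N} => K \subset ~: L)).
    exact: sum_iid_prob_is_support_le1.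
  by move=> K; rewrite L0 andbT -{1}(finset.setCK L) finset.setCS.
by rewrite sumEFin -mulr_sumr sum_weight// mulr1.
Qed.

End Support.

(** * Risk of a feasible point and the final bound *)

Lemma measurable_vle disp (Delta : measurableType disp) (R : realType) (q : nat)
    (b : Delta -> 'rV[R]_q) (u : 'rV[R]_q) :
  (forall l, measurable_fun setT (fun delta => b delta ord0 l)) ->
  measurable [set delta | vle u (b delta)].
Proof.
move=> hb; rewrite (_ : mkset _ =
    [set delta | [forall l, u ord0 l <= b delta ord0 l]]).
  apply: measurable_set_bool; apply: measurable_forall => l.
  exact: measurable_fun_ler.
by apply/seteqP; split => delta /= /forallP.
Qed.

(** If [delta] in place of scenario [i] is dominated, each component of [b delta] is at least that
    of some scenario in [K], which by feasibility is at least that of [g x]. So [x] also satisfies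
    the constraint of [delta]. *)
Lemma resample_prob_dominated_le disp (Delta : measurableType disp)
    (R : realType) (P : probability Delta R) (d q N : nat)
    (b : Delta -> 'rV[R]_q)
    (hb : forall l, measurable_fun setT (fun delta => b delta ord0 l))
    (s : 'I_q -> 'S_N) (X : set 'rV[R]_d) (g : 'rV[R]_d -> 'rV[R]_q)
    (K : {set 'I_N}) (i : 'I_N) (w : N.-tuple Delta) x :
  i \notin K -> feasible X g b w x ->
  ((resample_prob P i (dominated b s K i) w)%:E <= 1 - risk P g b x)%E.
Proof.
move=> iK [_ gb].
have mV := measurable_vle (g x) hb.
have -> : (1 - risk P g b x = P [set delta | vle (g x) (b delta)])%E.
  by rewrite /risk -probability_setC ?setCK//; exact: measurableC.
rewrite fineK ?fin_num_measure//; last first.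
  by apply: measurable_resample; exact: measurable_dominated.
apply: le_measure; rewrite ?inE//.
  by apply: measurable_resample; exact: measurable_dominated.
move=> delta /forallP dom l; have /exists_inP[k kK] := dom l.
rewrite Order.ProdLexiOrder.leEprodlexi /= !tnth_upd eqxx => /andP[+ _].
rewrite ifN; last by apply: contraNneq iK => <-.
exact: le_trans (gb k l).
Qed.

Theorem proposition1 (R : realType)
  (disp : measure_display) (Delta : measurableType disp)
  (P : probability Delta R)
  (d q N : nat) (hq : (0 < q)%N) (hN : (0 < N)%N)
  (X : set 'rV[R]_d) (f : 'rV[R]_d -> R) (g : 'rV[R]_d -> 'rV[R]_q)
  (b : Delta -> 'rV[R]_q)
  (hb : forall l, measurable_fun setT (fun delta => b delta ord0 l))
  (beta : R) (hbeta : 0 < beta < 1)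
  (hfeas : forall n, (0 < n)%N ->
     {ae iid_prob P n, forall w, exists x, feasible X g b w x})
  (s : 'I_q -> 'S_N)
  (xhat : N.-tuple Delta -> 'rV[R]_d)
  (hxhat : forall w, (exists x, feasible X g b w x) ->
     feasible X g b w (xhat w))
  (hmeas : measurable [set w : N.-tuple Delta |
     (risk P g b (xhat w) <=
        (eps N beta #|argmin_set (Ordinal hN) s b w|)%:E)%E]) :
  ((1 - beta)%:E <= iid_prob P N [set w : N.-tuple Delta |
     (risk P g b (xhat w) <=
        (eps N beta #|argmin_set (Ordinal hN) s b w|)%:E)%E])%E.
Proof.
have beta0 : 0 <= beta by case/andP: hbeta => /ltW.
set E := [set w | _] in hmeas *.
suff PE : (iid_prob P N (~` E) <= beta%:E)%E.
  rewrite -[E]setCK probability_setC; last exact: measurableC.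
  by rewrite EFinB; apply: leeB.
have [Z [mZ PZ sZ]] := hfeas N hN.
pose S K w := risky b s P K (1 - eps N beta #|K|) w &&
              is_support b s K [set: 'I_N]%SET w.
have mS K : measurable_fun setT (S K).
  by apply: measurable_and; [exact: measurable_risky|exact: measurable_is_support].
(* Up to the null set [Z] of infeasible samples, the failure event is contained in [B]. *)
pose B w := [exists K : {set 'I_N}, (K != [set: 'I_N]%SET) && S K w].
have mB : measurable_fun setT B.
  by apply: measurable_exists => K; apply: measurable_and.
have sub : ~` E `<=` Z `|` [set w | B w].
  move=> w /= /negP; rewrite -ltNge => riskw.
  have [wZ|wZ] := pselect (Z w); [by left|right].
  have feas : feasible X g b w (xhat w).
    by apply: hxhat; apply: contrapT => nfeas; apply: wZ; exact: sZ.
  pose K := argmin_set (Ordinal hN) s b w.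
  have KT : K != [set: 'I_N]%SET.
    (* When all [N] scenarios are selected, [eps] is 1 and no risk exceeds it. *)
    apply/eqP => KT; move: riskw; rewrite -/K KT cardsT card_ord /eps ltnn.
    by rewrite ltNge probability_le1//; exact/measurableC/measurable_vle.
  apply/existsP; exists K; rewrite KT /S is_support_argmin_set andbT.
  apply/forall_inP => i; rewrite inE => iK.
  rewrite -lte_fin; apply: le_lt_trans (resample_prob_dominated_le P hb s iK feas) _.
  have riskf : risk P g b (xhat w) \is a fin_num.
    by apply: fin_num_measure; exact/measurableC/measurable_vle.
  by move: riskw; rewrite -(fineK riskf) -EFinB !lte_fin -/K; lra.
suff PB : (iid_prob P N [set w | B w] <= beta%:E)%E.
  apply: (le_trans (le_measure _ _ _ sub)).
  - by rewrite inE; exact: measurableC.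
  - by rewrite inE; apply: measurableU => //; exact: measurable_set_bool.
  apply: (le_trans (measureU2 _ _ _)) => //; first exact: measurable_set_bool.
  by rewrite [X in (X + _)%E]PZ add0e.
(* Union bound over [K]: the indicator of [B] is at most the sum of those of the [S K]. *)
apply: le_trans (sum_iid_prob_risky_le s hb P hN hbeta).
rewrite -(integral_natr_bool _ mB).
rewrite (eq_bigr (fun K => \int[iid_prob P N]_w ((S K w)%:R : R)%:E)%E); last first.
  by move=> K _; rewrite integral_natr_bool.
rewrite -[leRHS]big_filter -ge0_integral_sum//; last first.
  by move=> K; apply/measurable_EFinP; exact: measurable_natr_bool.
apply: ge0_le_integral => //.
- by apply/measurable_EFinP; exact: measurable_natr_bool.
- apply: emeasurable_sum => K; apply/measurable_EFinP; exact: measurable_natr_bool.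
move=> w _; rewrite big_filter sumEFin lee_fin.
have [/existsP[K /andP[KT SK]]|_] := boolP (B w); last by rewrite sumr_ge0.
by rewrite (bigD1 K)//= SK lerDl sumr_ge0.
Qed.
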